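(* Let $\mathcal{C}=(C,Q,\mathcal{T})$ be a $\preceq_0$-compatible counter system induced by disjunctive guard transitions (with initial states $c_0\in C$, $Q_0\subseteq Q$), and let $\mathcal{C}_\alpha$ be its $01$-counter system. Then $\mathsf{Traces}_\infty(\mathcal{C})=\mathsf{Traces}_\infty(\mathcal{C}_\alpha)$.
   Context: A counter system (CS) is a triple $\mathcal{C}=(C,Q,\mathcal{T})$ with $C$ a finite set (controller states), $Q$ a finite set (user states), and a step relation $\mathcal{T}\subseteq(C\times\mathbb{N}^Q)\times(C\times\mathbb{N}^Q)$ such that $\sum_q\mathbf{v}(q)=\sum_q\mathbf{v}'(q)$ whenever $((c,\mathbf{v}),(c',\mathbf{v}'))\in\mathcal{T}$. Write $(c,\mathbf{v})\to(c',\mathbf{v}')$ for $((c,\mathbf{v}),(c',\mathbf{v}'))\in\mathcal{T}$. Initial configurations are the $(c_0,\mathbf{v}_0)$ with $\mathbf{v}_0(q)=0$ for all $q\notin Q_0$. A run is a (finite or infinite) sequence of steps starting in an initial configuration. Disjunctive guard transitions have the form $p\xrightarrow{G_\exists}q$ with $p,q\in C$ or $p,q\in Q$, and $G_\exists\subseteq C\cup Q$. A configuration $(c,\mathbf{v})$ satisfies $G_\exists$ if $c\in G_\exists$ or $\mathbf{v}(r)\ge1$ for some $r\in G_\exists$. A disjunctive guard step on $p\xrightarrow{G_\exists}q$ is possible from a configuration $(c,\mathbf{v})$ satisfying $G_\exists$: if $p,q\in Q$, it leads to $(c,\mathbf{v}-i\cdot\mathbf{p}+i\cdot\mathbf{q})$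 for some $1\le i\le\mathbf{v}(p)$ (where $\mathbf{p},\mathbf{q}$ are the unit vectors of $p,q$); if $p,q\in C$ and $c=p$, it leads to $(q,\mathbf{v})$; in both cases it is required that the resulting configuration also satisfies $G_\exists$. $\mathcal{C}$ is induced by disjunctive guard transitions if $\mathcal{T}$ is the set of all disjunctive guard steps on the transitions of some finite set of such transitions. Order: $(c,\mathbf{v})\preceq_0(d,\mathbf{w})$ iff $c=d$ and, for all $q\in Q$, $\mathbf{v}(q)\le\mathbf{w}(q)$ and $(\mathbf{v}(q)=0\Leftrightarrow\mathbf{w}(q)=0)$. $\mathcal{C}$ is (fully) $\preceq_0$-compatible if both hold: whenever $(c,\mathbf{v})\to(c',\mathbf{v}')$ and $(c,\mathbf{v})\preceq_0(d,\mathbf{w})$, there is a step $(d,\mathbf{w})\to(d',\mathbf{w}')$ with $(c',\mathbf{v}')\preceq_0(d',\mathbf{w}')$; and whenever $(c,\mathbf{v})\to(c',\mathbf{v}')$ and $(c',\mathbf{v}')\preceq_0(d',\mathbf{w}')$, there is a step $(d,\mathbf{w})\to(d',\mathbf{w}')$ with $(c,\mathbf{v})\preceq_0(d,\mathbf{w})$. Abstraction: $\alpha(c,\mathbf{v})=(c,\mathbf{v}^\alpha)$ with $\mathbf{v}^\alpha(q)=1$ if $\mathbf{v}(q)\ge1$ and $0$ otherwise. The $01$-counter system $\mathcal{C}_\alpha$ has configurations $C\times\{0,1\}^Q$ and a step $(c,\mathbf{x})\to(c',\mathbf{x}')$ iff there is a step $(c,\mathbf{v})\to(c',\mathbf{v}')$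 in $\mathcal{T}$ with $\alpha(c,\mathbf{v})=(c,\mathbf{x})$ and $\alpha(c',\mathbf{v}')=(c',\mathbf{x}')$. Its initial configurations are the $(c_0,\mathbf{x})$ with $\mathbf{x}(q)=0$ for all $q\notin Q_0$. Infinite traces: $\mathsf{Traces}_\infty(\mathcal{C})\subseteq C^\omega$ is the set of infinite words obtained from infinite runs of $\mathcal{C}$ by projecting each configuration to its first component (controller state) and removing duplicate adjacent letters (runs for which the result is a finite word contribute nothing). $\mathsf{Traces}_\infty(\mathcal{C}_\alpha)$ is defined in the same way from infinite runs of $\mathcal{C}_\alpha$. *)

(* Defs.v *)
From mathcomp Require Import all_boot classical_sets.

Set Implicit Arguments.
Unset Strict Implicit.
Unset Printing Implicit Defensive.

(* Configurations (c, v) with v in N^Q *)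
Definition config (C Q : finType) : Type := (C * {ffun Q -> nat})%type.

Record counter_system (C Q : finType) := CounterSystem {
  cs_step : config C Q -> config C Q -> Prop;
  cs_step_sum : forall s t, cs_step s t ->
    \sum_(q : Q) s.2 q = \sum_(q : Q) t.2 q
}.

(* A transition is its guard, a subset of the disjoint union of C and Q,
   together with a pair (p, q) of either controller or user states. *)
Definition transition (C Q : finType) : Type :=
  ({set (C + Q)%type} * ((C * C) + (Q * Q)))%type.

Definition sat_guard (C Q : finType) (G : {set (C + Q)%type})
    (s : config C Q) : Prop :=
  inl s.1 \in G \/ exists r : Q, inr r \in G /\ 1 <= s.2 r.

(* Since i <= v p, the natural-number subtraction does not truncate. *)
Definition fire (C Q : finType) (e : (C * C) + (Q * Q))
    (s t : config C Q) : Prop :=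
  match e with
  | inl (p, q) => s.1 = p /\ t = (q, s.2)
  | inr (p, q) => exists i : nat,
      [/\ 1 <= i, i <= s.2 p
        & t = (s.1, [ffun r => s.2 r - i * (r == p) + i * (r == q)])]
  end.

Definition guard_step (C Q : finType) (tr : transition C Q)
    (s t : config C Q) : Prop :=
  [/\ sat_guard tr.1 s, fire tr.2 s t & sat_guard tr.1 t].

(* As C and Q are finite there are only finitely many transitions. *)
Definition induced_by_disjunctive_guards (C Q : finType)
    (S : counter_system C Q) : Prop :=
  exists D : {set transition C Q}, forall s t,
    cs_step S s t <-> exists2 tr, tr \in D & guard_step tr s t.

Definition prec0 (C Q : finType) (s t : config C Q) : Prop :=
  s.1 = t.1 /\
  forall q : Q, s.2 q <= t.2 q /\ (s.2 q = 0 <-> t.2 q = 0).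

Definition compatible (C Q : finType) (le : config C Q -> config C Q -> Prop)
    (S : counter_system C Q) : Prop :=
  (forall s s' t, cs_step S s s' -> le s t ->
     exists t', cs_step S t t' /\ le s' t') /\
  (forall s s' t', cs_step S s s' -> le s' t' ->
     exists t, cs_step S t t' /\ le s t).

(* Systems whose configurations carry a controller state: the common setting
   for the traces of a counter system and of its 01-counter system. *)
Record control_system (C : Type) := ControlSystem {
  state : Type;
  control : state -> C;
  initial : state -> Prop;
  step : state -> state -> Prop
}.

Definition concrete_system (C Q : finType) (S : counter_system C Q)
    (c0 : C) (Q0 : {set Q}) : control_system C :=
  {| state := config C Q;
     control := fst;
     initial := fun s => s.1 = c0 /\ forall q, q \notin Q0 -> s.2 q = 0;
     step := cs_step S |}.

(* {0,1} is rendered by bool, with 1 as true. *)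
Definition config01 (C Q : finType) : Type := (C * {ffun Q -> bool})%type.

Definition alpha (C Q : finType) (s : config C Q) : config01 C Q :=
  (s.1, [ffun q => 1 <= s.2 q]).

Definition system01 (C Q : finType) (S : counter_system C Q)
    (c0 : C) (Q0 : {set Q}) : control_system C :=
  {| state := config01 C Q;
     control := fst;
     initial := fun x => x.1 = c0 /\ forall q, q \notin Q0 -> x.2 q = false;
     step := fun x y =>
       exists s t, [/\ cs_step S s t, alpha s = x & alpha t = y] |}.

Definition infinite_run (C : Type) (A : control_system C)
    (rho : nat -> state A) : Prop :=
  initial (rho 0) /\ forall n, step (rho n) (rho n.+1).

Definition kept (C : eqType) (u : nat -> C) (i : nat) : bool :=
  if i is j.+1 then u i != u j else true.

(* w is the infinite word left after deleting from u every letter equal to its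
   predecessor: f enumerates the surviving positions in increasing order. No
   such f exists when only finitely many letters survive. *)
Definition destutters_to (C : eqType) (u w : nat -> C) : Prop :=
  exists f : nat -> nat,
    [/\ forall i j, i < j -> f i < f j,
        forall i, kept u i <-> exists k, f k = i
      & forall k, w k = u (f k)].

Definition traces_infty (C : eqType) (A : control_system C) :
    set (nat -> C) :=
  [set w | exists rho : nat -> state A,
     infinite_run rho /\
     destutters_to (fun n => control (rho n)) w]%classic.

(* Main.v *)
Require Import Defs.
From mathcomp Require Import all_boot boolp classical_sets.

Set Implicit Arguments.
Unset Strict Implicit.
Unset Printing Implicit Defensive.

(** Disjunctive guards are monotone in the set of occupied user states, and
    traces forget stuttering. An abstract run is therefore followed by a
    concrete one that never empties a user state: the first time the abstract
    run visits [q], through [p -> q], at most half of the processes in [p] move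
    to [q]; every other user step is skipped. If the states occupied initially
    start with [2 ^ k] processes, where [k] counts the remaining states, none is
    ever exhausted. Since infinitely many controller changes remain, deleting
    the skipped steps leaves an infinite run with the same trace. *)

Lemma kept_comp (T U : eqType) (h : T -> U) (u : nat -> T) i :
  kept (h \o u) i -> kept u i.
Proof. by case: i => //= i; apply: contraNneq => ->. Qed.

Lemma eq_until_kept (T : eqType) (u : nat -> T) (f : nat -> nat) :
  {mono f : m n / m < n} -> (forall i, kept u i -> exists k, f k = i) ->
  forall k i, f k <= i < f k.+1 -> u i = u (f k).
Proof.
move=> fM fS k; elim=> [|i IHi] /andP[]; first by rewrite leqn0 => /eqP->.
rewrite leq_eqVlt => /predU1P[->//|ki ik].
rewrite -IHi ?(ltnW ik) ?andbT //.
have [/fS[m fm]|/negPn/eqP//] := boolP (kept u i.+1).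
by move: ki ik; rewrite -fm !fM ltnS => + mk; rewrite ltnNge mk.
Qed.

(** Position 0 always survives, so [f] starts there. Between survivors [u] is constant, so the
    letter just before survivor [k.+1] is still [v k]. *)
Lemma destutters_toP (T : eqType) (u v : nat -> T) :
  destutters_to u v ->
  exists f : nat -> nat,
    [/\ {mono f : m n / m < n}, forall i, kept u i <-> exists k, f k = i,
        forall k, v k = u (f k), f 0 = 0
      & forall k, 0 < f k.+1 /\ u (f k.+1).-1 = v k].
Proof.
case=> f [fI fS fV]; exists f.
have fM : {mono f : m n / m < n}.
  by apply: leqW_mono; apply: leq_mono => m n; apply: fI.
have f_gt0 k : 0 < f k.+1 by rewrite (leq_trans _ (fI k k.+1 _)).
split=> //; last first.
  move=> k; split=> //; rewrite fV.
  apply: (eq_until_kept fM (fun i => (fS i).1)).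
  by rewrite -ltnS prednK // leqnn andbT fI.
by have [[//|k] fk] := (fS 0).1 isT; have := f_gt0 k; rewrite fk.
Qed.

Lemma destutters_to_exists (T : eqType) (u : nat -> T) :
  (forall n, exists i, (n <= i) && kept u i) -> exists v, destutters_to u v.
Proof.
move=> inf; pose next n := ex_minn (inf n).
have nextP n : [/\ n <= next n, kept u (next n)
    & forall i, n <= i -> kept u i -> next n <= i].
  rewrite /next; case: ex_minnP => m /andP[nm km] mmin; split=> // i ni ki.
  by apply: mmin; rewrite ni.
pose f := nat_rect (fun=> nat) (next 0) (fun _ m => next m.+1).
have fS k : f k < f k.+1 by case: (nextP (f k).+1).
have fI : {homo f : m n / m < n}.
  by apply: homo_ltn => // x y z; apply: ltn_trans.
have f_ge k : k <= f k by elim: k => // k IHk; apply: leq_ltn_trans (fS k).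
exists (u \o f), f; split=> //.
move=> i; split=> [ki|[k <-]]; last first.
  by case: k => [|k]; [case: (nextP 0) | case: (nextP (f k).+1)].
(* A surviving [i] lies below some [f n]; induction on [n] traps it between consecutive values of
   [f], where minimality of [next] forces equality. *)
have [n] : exists n, i < f n by exists i.+1; apply: f_ge.
elim: n => [|k IHk].
  by case: (nextP 0) => _ _ /(_ i isT ki) le0i; rewrite ltnNge le0i.
move=> ik; have [/IHk//|] := ltnP i (f k).
rewrite leq_eqVlt => /predU1P[ki_eq|ki_lt]; first by exists k.
by case: (nextP (f k).+1) => _ _ /(_ i ki_lt ki); rewrite leqNgt ik.
Qed.

(** A position kept by [h \o u] is kept by [u], so [f] factors through [g]; the factor [e]
    enumerates the survivors of [h \o v]. *)
Lemma destutters_to_comp (T U : eqType) (h : T -> U) (u v : nat -> T) w :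
  destutters_to u v -> destutters_to (h \o u) w -> destutters_to (h \o v) w.
Proof.
move=> /destutters_toP[g [gM gS gV g0 gP]] [f [fI fS fV]].
have gI : injective g by apply/incn_inj/leq_mono => i j; rewrite gM.
have keptg j : kept (h \o v) j = kept (h \o u) (g j).
  case: j => [|j]; first by rewrite g0.
  by have [g_gt0 gj] := gP j; rewrite -(prednK g_gt0) /= prednK // gj gV.
have /choice[e eP] k : exists j, g j = f k.
  by apply/gS/(@kept_comp _ _ h)/fS; exists k.
exists e; split=> [i j ij|j|k]; first by rewrite -gM !eP fI.
  rewrite keptg fS; split=> -[k fk]; exists k; last by rewrite -eP fk.
  by apply: gI; rewrite eP.
by rewrite /= gV eP fV.
Qed.

(** Destuttering the configurations, and not just their controllers, gives a genuine run: a survivor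
    after the first differs from its predecessor, so an [R] step leads into it. Infinitely many
    survive because the controller changes infinitely often. *)
Lemma traces_infty_stuttering (C T : eqType) (h : T -> C) (ini : T -> Prop)
    (R : T -> T -> Prop) (u : nat -> T) (w : nat -> C) :
  ini (u 0) -> (forall n, u n = u n.+1 \/ R (u n) (u n.+1)) ->
  destutters_to (h \o u) w ->
  traces_infty (ControlSystem h ini R) w.
Proof.
move=> ini0 uS uw; have [f [fI fS fV]] := uw.
have [|v uv] := @destutters_to_exists _ u.
  move=> n; exists (f n); apply/andP; split.
    by elim: n => // n IHn; apply: leq_ltn_trans IHn (fI _ _ _).
  by apply/(@kept_comp _ _ h)/fS; exists n.
exists v; split; last exact: destutters_to_comp uv uw.
have [g [gM gS gV g0 gP]] := destutters_toP uv.
split=> [|k] /=; first by rewrite gV g0.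
have [g_gt0 gk] := gP k; have kg : kept u (g k.+1) by apply/gS; exists k.+1.
move: kg gk; rewrite (gV k.+1) -(prednK g_gt0) /= => /eqP neq <-.
by have [eq|//] := uS (g k.+1).-1; case: neq.
Qed.

Section Simulation.
Variables (C Q : finType).
Implicit Types (s t : config C Q) (x y : config01 C Q) (V : {set Q}).

Definition occupied x : {set Q} := [set q | x.2 q].

(* The unvisited states are the complement of [V]: each of their first visits
   may halve the population of a visited state. *)
Definition populated V s : Prop := forall q, q \in V -> 2 ^ #|~: V| <= s.2 q.

Lemma populated_gt0 V s q : populated V s -> q \in V -> 0 < s.2 q.
Proof. by move=> Vs /Vs; apply: leq_trans; rewrite expn_gt0. Qed.

Lemma sat_guard_le (G : {set (C + Q)%type}) s t :
  s.1 = t.1 -> (forall q, 0 < s.2 q -> 0 < t.2 q) ->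
  sat_guard G s -> sat_guard G t.
Proof.
move=> st1 st2 [Gs|[r [Gr sr]]]; [left; by rewrite -st1 | right].
by exists r; split=> //; apply: st2.
Qed.

Lemma occupied_alpha s q : (q \in occupied (alpha s)) = (0 < s.2 q).
Proof. by rewrite inE ffunE. Qed.

Lemma sat_guard_populated (G : {set (C + Q)%type}) s0 s V :
  s0.1 = s.1 -> occupied (alpha s0) \subset V -> populated V s ->
  sat_guard G s0 -> sat_guard G s.
Proof.
move=> s01 /fintype.subsetP s0V Vs; apply: sat_guard_le => // q s0q.
by apply: populated_gt0 Vs _; apply: s0V; rewrite occupied_alpha.
Qed.

Lemma simulate_guard_step (tr : transition C Q) s0 t0 s V :
  guard_step tr s0 t0 -> s0.1 = s.1 -> occupied (alpha s0) \subset V ->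
  populated V s ->
  exists t, [/\ t0.1 = t.1, populated (V :|: occupied (alpha t0)) t
    & s = t \/ guard_step tr s t].
Proof.
case: tr => G [] [p q] [/= Gs0 st0 Gt0] s01 s0V Vs.
  have [s0p t0E] := st0; exists (q, s.2).
  have VE : V :|: occupied (alpha t0) = V.
    apply/finset.setUidPl; apply: fintype.subset_trans s0V.
    apply/fintype.subsetP => r.
    by rewrite !occupied_alpha t0E.
  have Vt : populated V (q, s.2) by [].
  rewrite VE t0E; split=> //; right; split=> /=.
  - exact: sat_guard_populated s01 s0V Vs Gs0.
  - by rewrite -s01.
  - apply: (sat_guard_populated _ _ Vt Gt0); first by rewrite t0E.
    exact/finset.setUidPl.
have [i [i_gt0 ip t0E]] := st0.
have pV : p \in V.
  by apply: (fintype.subsetP s0V); rewrite occupied_alpha (leq_trans i_gt0).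
have t01 : t0.1 = s.1 by rewrite t0E.
(* Only [q] can become newly occupied, and it is occupied because [i] is positive. *)
have VE : V :|: occupied (alpha t0) = q |: V.
  apply/finset.setP => r; rewrite finset.in_setU finset.in_setU1 orbC.
  rewrite occupied_alpha t0E /= ffunE.
  have [->|rq] := eqVneq r q; first by rewrite muln1 addn_gt0 i_gt0 orbT.
  rewrite muln0 addn0; apply: orb_idl => r_gt0; apply: (fintype.subsetP s0V).
  by rewrite occupied_alpha (leq_trans r_gt0) // leq_subr.
rewrite VE; have [qV|qV] := boolP (q \in V).
  by exists s; rewrite (finset.setUidPr _) ?finset.sub1set //; split=> //; left.
(* The bound due once [q] is visited is half the old one: [p] can give [j] processes and keep at
   least [j]. *)
pose j := 2 ^ #|~: (q |: V)|.
have jE : 2 ^ #|~: V| = j + j.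
  rewrite addnn -mul2n -expnS /j; congr (2 ^ _).
  rewrite (cardsD1 q) inE qV add1n; congr (_.+1).
  by apply: eq_card => r; rewrite !inE negb_or.
have j_gt0 : 0 < j by rewrite expn_gt0.
pose t : config C Q :=
  (s.1, [ffun r => s.2 r - j * (r == p) + j * (r == q)]).
have Vt : populated (q |: V) t.
  move=> r; rewrite finset.in_setU1 ffunE -/j => /predU1P[->|rV].
    by rewrite eqxx muln1 leq_addl.
  apply: leq_trans (leq_addr _ _); have := Vs r rV; rewrite jE => jr.
  by rewrite leq_subRL ?(leq_trans _ jr) ?leq_add2r //;
    case: (r == p); rewrite ?muln1 ?muln0 ?leq_addr.
exists t; split=> //; right; split=> /=.
- exact: sat_guard_populated s01 s0V Vs Gs0.
- exists j; split=> //; apply: leq_trans (Vs p pV).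
  by rewrite jE leq_addr.
- by apply: (sat_guard_populated _ _ Vt Gt0); rewrite // -VE finset.subsetUr.
Qed.

End Simulation.

Theorem lemma7 (C Q : finType) (S : counter_system C Q)
    (c0 : C) (Q0 : {set Q})
    (hcompat : compatible (@prec0 C Q) S)
    (hguards : induced_by_disjunctive_guards S) :
  traces_infty (concrete_system S c0 Q0) = traces_infty (system01 S c0 Q0).
Proof.
apply/seteqP; split=> w [rho [[[rho01 rho02] rhoS] rhow]].
  exists (fun n => alpha (rho n)); split=> //; split=> [|n].
    by split=> // q /rho02 /= rhoq; rewrite ffunE rhoq.
  by exists (rho n), (rho n.+1); split=> //; apply: rhoS.
have [D DP] := hguards.
(* [V n] collects every state visited up to time [n], including those the abstract run has emptied
   since. *)
pose V := nat_rect (fun=> {set Q}) (occupied (rho 0))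
  (fun n W => W :|: occupied (rho n.+1)).
have rhoV n : occupied (rho n) \subset V n.
  by case: n => //= n; apply: finset.subsetUr.
pose inv n (s : config C Q) := (rho n).1 = s.1 /\ populated (V n) s.
(* Taking the invariant as a premise makes the successor total, as choice requires; where it fails,
   [s] is a dummy value. *)
have /choice[F FP] (ns : nat * config C Q) : exists t, inv ns.1 ns.2 ->
    inv ns.1.+1 t /\ (ns.2 = t \/ cs_step S ns.2 t).
  case: ns => n s /=; have [[rhos Vs]|] := pselect (inv n s); last by exists s.
  (* The witnesses of an abstract step vary from step to step and need not chain; only their
     abstractions match [rho]. *)
  have [s0 [t0 [/DP[tr trD st0] s0E t0E]]] := rhoS n.
  have := rhoV n; rewrite -s0E => s0V.
  have [|t [t01 Vt tS]] := simulate_guard_step st0 _ s0V Vs.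
    by rewrite -rhos -s0E.
  exists t => _; split; first by rewrite /inv /= -t0E.
  by case: tS => [->|tS]; [left | right; apply/DP; exists tr].
pose s0 : config C Q := (c0, [ffun q => (rho 0).2 q * 2 ^ #|~: V 0|]).
pose u := nat_rect (fun=> config C Q) s0 (fun n s => F (n, s)).
have uinv n : inv n (u n).
  elim: n => [|n IHn]; last by case: (FP (n, u n) IHn).
  by split=> // q; rewrite inE ffunE => ->; rewrite mul1n.
apply: (@traces_infty_stuttering _ _ _ _ _ u).
- by split=> // q /rho02 rhoq; rewrite ffunE rhoq.
- by move=> n; case: (FP (n, u n) (uinv n)).
- suff -> : fst \o u = fun n => control (rho n) by [].
  by apply/funext => n; case: (uinv n).
Qed.
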